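(* Let $\mathsf{B}$ be a bicategory and let $A,B$ be $0$-cells of $\mathsf{B}$. Assume that $A$ is equivalent to $B$ inside $\mathsf{B}$ via $1$-cells $f\in{}_A\mathsf{B}_B$, $g\in{}_B\mathsf{B}_A$ and isomorphisms ($2$-cells) $\eta: fg\to\mathbb{I}_A$ and $\theta:\mathbb{I}_B\to gf$. Then: (i) $\mathfrak{r}_{fg}\circ(1_{fg}\,\eta)=\mathfrak{l}_{fg}\circ(\eta\,1_{fg})$ as $2$-cells $(fg)(fg)\to fg$, and $(\theta\,1_{gf})\circ\mathfrak{l}_{gf}^{-1}=(1_{gf}\,\theta)\circ\mathfrak{r}_{gf}^{-1}$ as $2$-cells $gf\to(gf)(gf)$. (ii) The functor $f-:{}_B\mathsf{B}_B\to{}_A\mathsf{B}_B$ (respectively $g-:{}_A\mathsf{B}_A\to{}_B\mathsf{B}_A$), defined by left multiplication by $f$ (respectively by $g$), is fully faithful. (iii) There exists a $2$-cell $\rho: gf\to\mathbb{I}_B$ such that $(f,g,\eta,\rho)$ is a wide right Morita context from $B$ to $A$.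
   Context: Conventions for bicategories. A bicategory $\mathsf{B}$ has a class of $0$-cells; for each pair of $0$-cells $A,B$ a category ${}_A\mathsf{B}_B$, whose objects are the $1$-cells from $B$ to $A$ and whose morphisms are the $2$-cells (composition in this category is written $\circ$); multiplication functors ${}_A\mathsf{B}_B\times{}_B\mathsf{B}_C\to{}_A\mathsf{B}_C$, $(f,g)\mapsto fg$ on $1$-cells and $(\alpha,\beta)\mapsto\alpha\beta$ on $2$-cells; identity $1$-cells $\mathbb{I}_A\in{}_A\mathsf{B}_A$; and natural isomorphisms $\mathfrak{a}_{f,g,h}:(fg)h\to f(gh)$, $\mathfrak{r}_f:f\mathbb{I}_B\to f$, $\mathfrak{l}_f:\mathbb{I}_Af\to f$ satisfying the usual pentagon and triangle axioms. $1_f$ denotes the identity $2$-cell of $f$. Equivalence. $A$ is equivalent to $B$ inside $\mathsf{B}$ if there are $1$-cells $f\in{}_A\mathsf{B}_B$, $g\in{}_B\mathsf{B}_A$ and isomorphisms $\eta:fg\to\mathbb{I}_A$ in ${}_A\mathsf{B}_A$ and $\theta:\mathbb{I}_B\to gf$ in ${}_B\mathsf{B}_B$ (no further compatibility is required). Left multiplication. The functor $f-$ sends a $1$-cell $h$ to $fh$ and a $2$-cell $\sigma$ to $1_f\,\sigma$; similarly for $g-$. Wide right Morita context. A wide right Morita context from $B$ to $A$ is a four-tuple $(f,g,\eta,\rho)$ with $f\in{}_A\mathsf{B}_B$, $g\in{}_B\mathsf{B}_A$ and $2$-cells $\eta:fg\to\mathbb{I}_A$, $\rho:gf\to\mathbb{I}_B$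 such that $$\mathfrak{r}_g\circ(1_g\,\eta)\circ\mathfrak{a}_{g,f,g}=\mathfrak{l}_g\circ(\rho\,1_g),\qquad \mathfrak{l}_f\circ(\eta\,1_f)=\mathfrak{r}_f\circ(1_f\,\rho)\circ\mathfrak{a}_{f,g,f}.$$ *)

(* Defs.v *)
From mathcomp Require Import ssreflect ssrfun.

Set Implicit Arguments.
Unset Strict Implicit.
Unset Printing Implicit Defensive.

Declare Scope bicat_scope.
Delimit Scope bicat_scope with bicat.
Local Open Scope bicat_scope.

Reserved Notation "v ∘ u" (at level 50, left associativity).
Reserved Notation "f ⋅ g" (at level 40, left associativity).
Reserved Notation "a ⊗ b" (at level 40, left associativity).

Record category := Category {
  obj :> Type;
  hom : obj -> obj -> Type;
  idm : forall x, hom x x;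
  comp : forall x y z, hom y z -> hom x y -> hom x z;
  comp1m : forall x y (u : hom x y), comp (idm y) u = u;
  compm1 : forall x y (u : hom x y), comp u (idm x) = u;
  compA : forall x y z t (w : hom z t) (v : hom y z) (u : hom x y),
    comp w (comp v u) = comp (comp w v) u
}.

Arguments hom {c} x y.
Arguments idm {c} x.
Arguments comp {c x y z} v u.

Notation "v ∘ u" := (comp v u) : bicat_scope.

Record iso (C : category) (x y : C) := Iso {
  iso_hom :> hom x y;
  iso_inv : hom y x;
  iso_homK : iso_inv ∘ iso_hom = idm x;
  iso_invK : iso_hom ∘ iso_inv = idm y
}.

Definition prod_category (C D : category) : category.
Proof.
refine (@Category (C * D)%type
  (fun p q => (hom p.1 q.1 * hom p.2 q.2)%type)
  (fun p => (idm p.1, idm p.2))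
  (fun p q r v u => (v.1 ∘ u.1, v.2 ∘ u.2)) _ _ _).
- by move=> p q [u1 u2] /=; rewrite !comp1m.
- by move=> p q [u1 u2] /=; rewrite !compm1.
- by move=> p q r s w v u /=; rewrite !compA.
Defined.

Record functor (C D : category) := Functor {
  fobj :> C -> D;
  fmap : forall x y, hom x y -> hom (fobj x) (fobj y);
  fmap1 : forall x, fmap (idm x) = idm (fobj x);
  fmapM : forall x y z (v : hom y z) (u : hom x y),
    fmap (v ∘ u) = fmap v ∘ fmap u
}.

Arguments fmap {C D} f {x y} u.

Definition fully_faithful (C D : category) (F : functor C D) : Prop :=
  forall x y : C, bijective (fun u : hom x y => fmap F u).

(* [cells1 A B] is the category written _A B_B: its objects are the 1-cells
   from B to A, so products of 1-cells read from left to right. *)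
Record bicategory_data := BicategoryData {
  cell0 :> Type;
  cells1 : cell0 -> cell0 -> category;
  mul : forall A B C,
    functor (prod_category (cells1 A B) (cells1 B C)) (cells1 A C);
  unit1 : forall A, cells1 A A;
  assoc : forall A B C D (f : cells1 A B) (g : cells1 B C) (h : cells1 C D),
    iso (mul A C D (mul A B C (f, g), h)) (mul A B D (f, mul B C D (g, h)));
  runit : forall A B (f : cells1 A B), iso (mul A B B (f, unit1 B)) f;
  lunit : forall A B (f : cells1 A B), iso (mul A A B (unit1 A, f)) f
}.

Arguments cells1 {b} A B.
Arguments mul {b} A B C.
Arguments unit1 {b} A.
Arguments assoc {b A B C D} f g h.
Arguments runit {b A B} f.
Arguments lunit {b A B} f.

Definition mul1 (BB : bicategory_data) (A B C : BB)
  (f : cells1 A B) (g : cells1 B C) : cells1 A C := mul A B C (f, g).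

Notation "f ⋅ g" := (mul1 f g) : bicat_scope.

Definition mul2 (BB : bicategory_data) (A B C : BB)
  (f f' : cells1 A B) (g g' : cells1 B C) (a : hom f f') (b : hom g g') :
  hom (f ⋅ g) (f' ⋅ g') :=
  @fmap _ _ (mul A B C) (f, g) (f', g') (a, b).

Notation "a ⊗ b" := (mul2 a b) : bicat_scope.

Record bicategory := Bicategory {
  bicat_data :> bicategory_data;
  assoc_natural : forall (A B C D : bicat_data)
    (f f' : cells1 A B) (g g' : cells1 B C) (h h' : cells1 C D)
    (a : hom f f') (b : hom g g') (c : hom h h'),
    assoc f' g' h' ∘ ((a ⊗ b) ⊗ c) = (a ⊗ (b ⊗ c)) ∘ assoc f g h;
  runit_natural : forall (A B : bicat_data) (f f' : cells1 A B) (a : hom f f'),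
    runit f' ∘ (a ⊗ idm (unit1 B)) = a ∘ runit f;
  lunit_natural : forall (A B : bicat_data) (f f' : cells1 A B) (a : hom f f'),
    lunit f' ∘ (idm (unit1 A) ⊗ a) = a ∘ lunit f;
  pentagon : forall (A B C D E : bicat_data) (f : cells1 A B)
    (g : cells1 B C) (h : cells1 C D) (k : cells1 D E),
    assoc f g (h ⋅ k) ∘ assoc (f ⋅ g) h k =
    (idm f ⊗ assoc g h k) ∘ assoc f (g ⋅ h) k ∘ (assoc f g h ⊗ idm k);
  triangle : forall (A B C : bicat_data) (f : cells1 A B) (g : cells1 B C),
    (idm f ⊗ lunit g) ∘ assoc f (unit1 B) g = runit f ⊗ idm g
}.

Definition left_mul (BB : bicategory_data) (A B : BB) (f : cells1 A B) (C : BB) :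
  functor (cells1 B C) (cells1 A C).
Proof.
refine (@Functor (cells1 B C) (cells1 A C)
  (fun h => f ⋅ h) (fun h k s => idm f ⊗ s) _ _).
- by move=> h; exact: (fmap1 (mul A B C) (f, h)).
- move=> h k l t s.
  rewrite -[in LHS](comp1m (idm f)).
  exact: (@fmapM _ _ (mul A B C) (f, h) (f, k) (f, l) (idm f, t) (idm f, s)).
Defined.

Definition wide_right_Morita_context (BB : bicategory) (A B : BB)
  (f : cells1 A B) (g : cells1 B A)
  (eta : hom (f ⋅ g) (unit1 A)) (rho : hom (g ⋅ f) (unit1 B)) : Prop :=
  runit g ∘ (idm g ⊗ eta) ∘ assoc g f g = lunit g ∘ (rho ⊗ idm g) /\
  lunit f ∘ (eta ⊗ idm f) = runit f ∘ (idm f ⊗ rho) ∘ assoc f g f.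

Arguments wide_right_Morita_context {BB A B} f g eta rho.

(* Main.v *)
From mathcomp Require Import ssreflect ssrfun.
Require Import Defs.

Set Implicit Arguments.
Unset Strict Implicit.
Unset Printing Implicit Defensive.

Local Open Scope bicat_scope.

(** Both halves of (i) are the fact that an isomorphism [e : x -> I] satisfies
    [r_x (1 e) = l_x (e 1)], which after composing with [e] reduces to
    [l_I = r_I].  For (ii), [g(f-)] and [f(g-)] are naturally isomorphic to
    identity functors.  For (iii), fullness of [f-] provides the unique [rho]
    satisfying the second Morita identity; the first one is checked after
    applying the faithful functor [f-], where it follows from the second one,
    the coherence axioms and (i). *)

Section Category.

Variable C : category.

Lemma iso_epi (x y z : C) (e : iso x y) (u v : hom y z) :
  u ∘ e = v ∘ e -> u = v.
Proof.
move=> /(congr1 (fun w => w ∘ iso_inv e)).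
by rewrite -!compA !iso_invK !compm1.
Qed.

Lemma iso_mono (x y z : C) (e : iso x y) (u v : hom z x) :
  e ∘ u = e ∘ v -> u = v.
Proof.
move=> /(congr1 (fun w => iso_inv e ∘ w)).
by rewrite !compA !iso_homK !comp1m.
Qed.

Lemma comp_iso_homK (x y z : C) (e : iso x y) (u : hom x z) :
  u ∘ iso_inv e ∘ e = u.
Proof. by rewrite -compA iso_homK compm1. Qed.

Definition iso_id (x : C) : iso x x :=
  Iso (comp1m (idm x)) (comp1m (idm x)).

Definition iso_sym (x y : C) (e : iso x y) : iso y x :=
  Iso (iso_invK e) (iso_homK e).

Definition iso_comp (x y z : C) (d : iso y z) (e : iso x y) : iso x z.
Proof.
refine (@Iso _ _ _ (d ∘ e) (iso_inv e ∘ iso_inv d) _ _).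
- by rewrite compA comp_iso_homK iso_homK.
- by rewrite compA -(compA d) iso_invK compm1 iso_invK.
Defined.

End Category.

Definition faithful (C D : category) (F : functor C D) : Prop :=
  forall (x y : C) (u v : hom x y), fmap F u = fmap F v -> u = v.

Section NaturalIso.

Variables (C D : category) (F : functor C D) (G : functor D C).
Variable n : forall x : C, iso x (G (F x)).
Hypothesis n_natural : forall (x y : C) (u : hom x y),
  n y ∘ u = fmap G (fmap F u) ∘ n x.

Lemma faithful_of_section : faithful F.
Proof.
by move=> x y u v uv; apply: (iso_mono (e := n y)); rewrite !n_natural uv.
Qed.

(** The inverse of [F] on hom-sets is [G] conjugated by [n]. That it is a right inverse can be
    tested after applying [G], by faithfulness. *)
Lemma fully_faithful_of_section : faithful G -> fully_faithful F.
Proof.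
move=> faithG x y; exists (fun u => iso_inv (n y) ∘ fmap G u ∘ n x).
- by move=> u; rewrite -compA -n_natural compA iso_homK comp1m.
- move=> u; apply: faithG; apply: (iso_epi (e := n x)).
  by rewrite -n_natural !compA iso_invK comp1m.
Qed.

End NaturalIso.

Section Bicategory.

Variable BB : bicategory.

Lemma mul2_id (A B C : BB) (f : cells1 A B) (g : cells1 B C) :
  idm f ⊗ idm g = idm (f ⋅ g).
Proof. exact: (fmap1 (mul A B C) (f, g)). Qed.

Lemma mul2_comp (A B C : BB) (f f' f'' : cells1 A B) (g g' g'' : cells1 B C)
  (a' : hom f' f'') (a : hom f f') (b' : hom g' g'') (b : hom g g') :
  (a' ⊗ b') ∘ (a ⊗ b) = (a' ∘ a) ⊗ (b' ∘ b).
Proof.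
exact: esym (@fmapM _ _ (mul A B C) (f, g) (f', g') (f'', g'') (a', b') (a, b)).
Qed.

Lemma idm_mul_comp (A B C : BB) (f : cells1 A B) (g g' g'' : cells1 B C)
  (v : hom g' g'') (u : hom g g') :
  idm f ⊗ (v ∘ u) = (idm f ⊗ v) ∘ (idm f ⊗ u).
Proof. exact: (fmapM (left_mul f C)). Qed.

Lemma comp_mul_idm (A B C : BB) (f f' f'' : cells1 A B) (g : cells1 B C)
  (v : hom f' f'') (u : hom f f') :
  (v ∘ u) ⊗ idm g = (v ⊗ idm g) ∘ (u ⊗ idm g).
Proof. by rewrite mul2_comp comp1m. Qed.

Definition iso_mul (A B C : BB) (f f' : cells1 A B) (g g' : cells1 B C)
  (a : iso f f') (b : iso g g') : iso (f ⋅ g) (f' ⋅ g').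
Proof.
refine (@Iso _ _ _ (a ⊗ b) (iso_inv a ⊗ iso_inv b) _ _).
- by rewrite mul2_comp !iso_homK mul2_id.
- by rewrite mul2_comp !iso_invK mul2_id.
Defined.

(** Naturality of [lunit] recovers [u] from its whiskering by the unit. This allows coherence
    identities to be checked after multiplying by a unit, where pentagon and triangle apply. *)
Lemma unit1_mul_inj (A B : BB) (f g : cells1 A B) (u v : hom f g) :
  idm (unit1 A) ⊗ u = idm (unit1 A) ⊗ v -> u = v.
Proof.
by move=> uv; apply: (iso_epi (e := lunit f)); rewrite -!lunit_natural uv.
Qed.

Lemma mul_unit1_inj (A B : BB) (f g : cells1 A B) (u v : hom f g) :
  u ⊗ idm (unit1 B) = v ⊗ idm (unit1 B) -> u = v.
Proof.
by move=> uv; apply: (iso_epi (e := runit f)); rewrite -!runit_natural uv.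
Qed.

(** Kelly's argument: whiskered by a unit on the left, the identity follows from the pentagon for
    [I, I, f, g] and two triangles. *)
Lemma lunit_mul (A B C : BB) (f : cells1 A B) (g : cells1 B C) :
  lunit (f ⋅ g) ∘ assoc (unit1 A) f g = lunit f ⊗ idm g.
Proof.
apply: unit1_mul_inj.
(* These are the first two associators on the long side of the pentagon. Both sides then reduce to
   [runit I ⊗ 1] after an associator. *)
apply: (iso_epi (e := iso_comp (assoc (unit1 A) (unit1 A ⋅ f) g)
                               (iso_mul (assoc (unit1 A) (unit1 A) f)
                                        (iso_id g)))).
rewrite /= idm_mul_comp !compA.
rewrite -assoc_natural -[in RHS]compA -comp_mul_idm triangle.
rewrite -!compA (compA _ (assoc _ _ _)) -pentagon compA triangle.
by rewrite -mul2_id assoc_natural.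
Qed.

(** Mirror argument, with the pentagon for [f, g, I, I]. *)
Lemma runit_mul (A B C : BB) (f : cells1 A B) (g : cells1 B C) :
  (idm f ⊗ runit g) ∘ assoc f g (unit1 C) = runit (f ⋅ g).
Proof.
apply: mul_unit1_inj.
apply: (iso_mono (e := assoc f g (unit1 C))).
rewrite comp_mul_idm compA assoc_natural.
rewrite -triangle idm_mul_comp.
rewrite -!compA (compA _ (assoc _ _ _)) -pentagon -triangle.
by rewrite !compA -assoc_natural mul2_id.
Qed.

(** Naturality of [lunit] at [lunit I] itself gives [lunit (I ⋅ I) = 1 ⊗ lunit I]. Then [lunit_mul]
    and the triangle identify the two unitors after tensoring with [I]. *)
Lemma lunit_unit1 (A : BB) : lunit (unit1 A) = runit (unit1 A) :> hom _ _.
Proof.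
apply: mul_unit1_inj; rewrite -triangle -lunit_mul; congr (_ ∘ _).
by apply: (iso_mono (e := lunit (unit1 A))); rewrite lunit_natural.
Qed.

Lemma runit_lunit_iso (A : BB) (x : cells1 A A) (e : iso x (unit1 A)) :
  runit x ∘ (idm x ⊗ e) = lunit x ∘ (e ⊗ idm x).
Proof.
apply: (iso_mono (e := e)).
(* Each side becomes a unitor of the unit 1-cell composed with [e ⊗ e]. *)
rewrite !compA -runit_natural -lunit_natural -!compA !mul2_comp.
by rewrite !comp1m !compm1 lunit_unit1.
Qed.

Lemma inv_runit_lunit_iso (A : BB) (x : cells1 A A) (e : iso (unit1 A) x) :
  (e ⊗ idm x) ∘ iso_inv (lunit x) = (idm x ⊗ e) ∘ iso_inv (runit x).
Proof.
have E := runit_lunit_iso (iso_sym e).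
set d := iso_comp (runit x) (iso_mul (iso_id x) (iso_sym e)).
apply: (iso_mono (e := d)).
(* The right-hand 2-cell is the inverse of [d]. By [E], [d] is also [lunit x] after [iso_inv e ⊗ 1],
   which the left-hand 2-cell inverts. *)
rewrite [RHS](iso_invK d) /= E compA -(compA (lunit x)).
by rewrite mul2_comp iso_homK comp1m mul2_id compm1 iso_invK.
Qed.

Section Equivalence.

Variables (A B : BB) (f : cells1 A B) (g : cells1 B A).
Variable theta : iso (unit1 B) (g ⋅ f).

(** The composite [h -> I h -> (g f) h -> g (f h)]. *)
Definition left_mul_section (C : BB) (h : cells1 B C) :
  iso h (left_mul g C (left_mul f C h)) :=
  iso_comp (assoc g f h)
    (iso_comp (iso_mul theta (iso_id h)) (iso_sym (lunit h))).

Lemma left_mul_section_natural (C : BB) (h k : cells1 B C) (u : hom h k) :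
  left_mul_section k ∘ u =
  fmap (left_mul g C) (fmap (left_mul f C) u) ∘ left_mul_section h.
Proof.
(* Precomposing with [lunit h] cancels the inverse unitor, so that [lunit_natural] applies
   directly. *)
apply: (iso_epi (e := lunit h)).
rewrite /= -!compA iso_homK compm1 -lunit_natural.
rewrite (compA (iso_inv _)) iso_homK comp1m.
rewrite (compA _ (assoc _ _ _)) -assoc_natural -compA !mul2_comp.
by rewrite mul2_id !comp1m !compm1.
Qed.

Lemma left_mul_faithful (C : BB) : faithful (left_mul f C).
Proof. exact: faithful_of_section (@left_mul_section_natural C). Qed.

End Equivalence.

Lemma left_mul_fully_faithful (A B C : BB) (f : cells1 A B) (g : cells1 B A)
  (eta : iso (f ⋅ g) (unit1 A)) (theta : iso (unit1 B) (g ⋅ f)) :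
  fully_faithful (left_mul f C).
Proof.
apply: (fully_faithful_of_section (left_mul_section_natural theta (C := C))).
(* The inverse of [eta] makes [g-] faithful, just as [theta] does for [f-]. *)
exact: left_mul_faithful (iso_sym eta) C.
Qed.

Lemma left_mul_Morita (A B : BB) (f : cells1 A B) (g : cells1 B A)
  (eta : iso (f ⋅ g) (unit1 A)) (rho : hom (g ⋅ f) (unit1 B)) :
  lunit f ∘ (eta ⊗ idm f) = runit f ∘ (idm f ⊗ rho) ∘ assoc f g f ->
  idm f ⊗ (runit g ∘ (idm g ⊗ eta) ∘ assoc g f g) =
  idm f ⊗ (lunit g ∘ (rho ⊗ idm g)).
Proof.
move=> M2.
apply: (iso_epi (e := iso_comp (assoc f (g ⋅ f) g)
                               (iso_mul (assoc f g f) (iso_id g)))).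
(* The first Morita side reaches this middle term by the pentagon, the unitor lemmas for products
   and (i) for [eta]. The second reaches it by [M2] and the triangle. *)
transitivity ((lunit f ∘ (eta ⊗ idm f)) ⊗ idm g).
  rewrite /= !idm_mul_comp.
  rewrite -!compA (compA _ (assoc f _ _)) -pentagon.
  rewrite (compA _ (assoc f g _)) -assoc_natural !compA runit_mul mul2_id.
  rewrite runit_lunit_iso -compA -mul2_id -assoc_natural compA lunit_mul.
  by rewrite comp_mul_idm.
rewrite M2 /= idm_mul_comp -[in RHS]compA.
rewrite (compA _ (assoc f _ _)) -assoc_natural.
by rewrite !compA triangle !comp_mul_idm.
Qed.

End Bicategory.

Theorem proposition1p1 (BB : bicategory) (A B : BB)
  (f : cells1 A B) (g : cells1 B A)
  (eta : iso (f ⋅ g) (unit1 A)) (theta : iso (unit1 B) (g ⋅ f)) :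
  (* (i) *)
  (runit (f ⋅ g) ∘ (idm (f ⋅ g) ⊗ eta) = lunit (f ⋅ g) ∘ (eta ⊗ idm (f ⋅ g)) /\
   (theta ⊗ idm (g ⋅ f)) ∘ iso_inv (lunit (g ⋅ f)) =
   (idm (g ⋅ f) ⊗ theta) ∘ iso_inv (runit (g ⋅ f))) /\
  (* (ii) *)
  (fully_faithful (left_mul f B) /\ fully_faithful (left_mul g A)) /\
  (* (iii) *)
  (exists rho : hom (g ⋅ f) (unit1 B), wide_right_Morita_context f g eta rho).
Proof.
have ff_f := left_mul_fully_faithful (C := B) eta theta.
split; first by split; [exact: runit_lunit_iso | exact: inv_runit_lunit_iso].
split.
  split=> //; exact: left_mul_fully_faithful (iso_sym theta) (iso_sym eta).
have [lift _ liftK] := ff_f (g ⋅ f) (unit1 B).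
(* The second Morita identity solved for [1_f rho], by inverting [runit f] and [assoc f g f]. *)
pose u : hom (f ⋅ (g ⋅ f)) (f ⋅ unit1 B) :=
  iso_inv (runit f) ∘ (lunit f ∘ (eta ⊗ idm f) ∘ iso_inv (assoc f g f)).
exists (lift u).
have M2 : lunit f ∘ (eta ⊗ idm f) =
          runit f ∘ (idm f ⊗ lift u) ∘ assoc f g f.
  rewrite [idm f ⊗ _](liftK u) /u (compA (runit f)) iso_invK comp1m.
  by rewrite comp_iso_homK.
split=> //; apply: (left_mul_faithful theta (C := A)).
exact: left_mul_Morita.
Qed.
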